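(* Let $\mathcal{Y}$ be a finite set, $Q$ an irreducible aperiodic Markov transition matrix on $\mathcal{Y}$, and $\nu$ a probability measure on $\mathcal{Y}$ reversible with respect to $Q$. For a positive integer $n$ let $\mathcal{X}_n=\mathcal{Y}^{n+1}$, let $\mu_n$ be the path measure on $\mathcal{X}_n$, and let $P_n$ be the Glauber dynamics transition matrix on $\mathcal{X}_n$ (both as defined in the context). Let $\lambda_1>0$ be a constant such that $\Lambda^{(1)}_{\mu_n}(P_n)\ge \frac{\lambda_1}{n+1}$. Suppose $f_n:\mathcal{X}_n\to\mathbb{R}$ satisfies $$\widetilde{\Phi}^{\mathrm{Lip}}_{\mathrm{asym}}(P_n;f_n)\le\frac{C}{(n+1)^p}$$ for some power $p\in\mathbb{R}$ and some $C>0$. Then for every $a\ge 0$, $$\ln\left(\mathcal{F}^+_{\mu_n}\big(f_n;\,a\,(n+1)^{-p+\frac12}\big)\right)\le\varkappa-\vartheta\left(a\cdot\frac{2\sqrt{\lambda_1}}{C}\right).$$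
   Context: Path measure: $\mu_n(x_0,\dots,x_n)=\nu(x_0)Q(x_0,x_1)\cdots Q(x_{n-1},x_n)$. Standing assumptions: $|\mathcal{Y}|\ge2$ and $\mu_n$ is non-degenerate, i.e. $\mu_n(x)>0$ for all $x\in\mathcal{X}_n$. Reversibility of $\nu$: $\nu(x)Q(x,y)=\nu(y)Q(y,x)$ for all $x,y\in\mathcal{Y}$. Glauber dynamics: with $x=(x_0,\dots,x_n)$, $y=(y_0,\dots,y_n)$ and $\delta$ the Kronecker delta, $P_n(x,y)=\frac1{n+1}\sum_{t=0}^nP_{n,t}(x,y)$, where $P_{n,t}$ resamples the coordinate $t$ from its conditional distribution under $\mu_n$ given the others: for $1\le t\le n-1$, $$P_{n,t}(x,y)=\frac{Q(x_{t-1},y_t)Q(y_t,x_{t+1})}{\sum_{z\in\mathcal{Y}}Q(x_{t-1},z)Q(z,x_{t+1})}\prod_{s\ne t}\delta(x_s,y_s),$$ $$P_{n,0}(x,y)=\frac{\nu(y_0)Q(y_0,x_1)}{\sum_{z\in\mathcal{Y}}\nu(z)Q(z,x_1)}\prod_{s\neq 0}\delta(x_s,y_s),\qquad P_{n,n}(x,y)=Q(x_{n-1},y_n)\prod_{s\ne n}\delta(x_s,y_s).$$ The measure $\mu_n$ is reversible for $P_n$. For a finite set $\mathcal{X}$, a transition matrix $P$ on it, and a non-degenerate reversible probability measure $\mu$ for $P$: the spectral gap is $\Lambda^{(1)}_\mu(P)=\min\{\mathcal{E}_{P,\mu}(g,g): g:\mathcal{X}\to\mathbb{R},\ \operatorname{Var}_\mu(g)\ge1\}$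 with $\mathcal{E}_{P,\mu}(g,g)=\frac12\sum_{x,y}(g(x)-g(y))^2\mu(x)P(x,y)$; the asymmetric Lipschitz constant is $$\widetilde{\Phi}^{\mathrm{Lip}}_{\mathrm{asym}}(P;f)=\max_{x\in\mathcal{X}}\Big(\sum_{y}P(x,y)|f(x)-f(y)|^2\mathbf{1}_{(0,\infty)}(f(x)-f(y))\Big)^{1/2};$$ and $\mathcal{F}^+_\mu(f;a)=\mu(\{x:f(x)-\mathbb{E}_\mu[f]\ge a\})$ for $a\ge0$, with $\ln0=-\infty$. The constant is $\varkappa=\sum_{k=1}^\infty2^k\ln\left(\frac1{1-4^{-k}}\right)$, and $\vartheta(x)=x\,\varphi(x)+\ln\left(\frac2x\varphi(x)\right)$ with $\varphi(x)=\sqrt{1+\frac1{x^2}}-\frac1x$ for $x>0$, and $\vartheta(0)=0$ (continuous extension). *)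

(* Defs.v *)
(* MathComp / MathComp-Analysis development, over an arbitrary R : realType. *)
From HB Require Import structures.
From mathcomp Require Export all_boot all_order all_algebra.
From mathcomp Require Export all_classical all_reals all_analysis.

Set Implicit Arguments.
Unset Strict Implicit.
Unset Printing Implicit Defensive.

Import Order.TTheory GRing.Theory Num.Theory.
Import numFieldNormedType.Exports.
Local Open Scope classical_set_scope.
Local Open Scope ring_scope.

Section FiniteChain.
Variables (R : realType) (X : finType).
Implicit Types (P : X -> X -> R) (mu f g : X -> R).

Definition is_proba mu : Prop :=
  (forall x, 0 <= mu x) /\ \sum_x mu x = 1.

Definition is_transition P : Prop :=
  (forall x y, 0 <= P x y) /\ (forall x, \sum_y P x y = 1).

Fixpoint kernel_pow P (k : nat) : X -> X -> R :=
  if k is k'.+1 then fun x y => \sum_z P x z * kernel_pow P k' z y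
  else fun x y => (x == y)%:R.

Definition irreducible_kernel P : Prop :=
  forall x y, exists k, 0 < kernel_pow P k x y.

(* The gcd of the set of return times is characterised by its universal
   property: 1 is the only common divisor. *)
Definition aperiodic P : Prop :=
  forall x (d : nat),
    (forall k, (0 < k)%N -> 0 < kernel_pow P k x x -> (d %| k)%N) -> d = 1%N.

Definition reversible_for mu P : Prop :=
  forall x y, mu x * P x y = mu y * P y x.

Definition expectation_on mu f : R := \sum_x mu x * f x.

Definition variance_on mu f : R :=
  expectation_on mu (fun x => (f x - expectation_on mu f) ^+ 2).

Definition dirichlet P mu g : R :=
  2^-1 * \sum_x \sum_y (g x - g y) ^+ 2 * (mu x * P x y).

(* For mu non-degenerate and #|X| > 1 the set is nonempty, bounded below by 0,
   and its infimum is attained, so inf is the minimum. *)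
Definition spectral_gap mu P : R :=
  inf [set dirichlet P mu g | g in [set g : X -> R | 1 <= variance_on mu g]].

(* The values are nonnegative, so 0 is a harmless default for the maximum. *)
Definition lip_asym P f : R :=
  \big[Num.max/0]_(x : X)
    Num.sqrt (\sum_y P x y * `|f x - f y| ^+ 2 * (0 < f x - f y)%R%:R).

Definition upper_tail mu f (a : R) : R :=
  \sum_(x | a <= f x - expectation_on mu f) mu x.

End FiniteChain.

Section PathSpace.
Variables (R : realType) (Y : finType).

Definition path_space (n : nat) : finType := {ffun 'I_n.+1 -> Y}.

Definition path_measure (Q : Y -> Y -> R) (nu : Y -> R) (n : nat)
    (x : path_space n) : R :=
  nu (x ord0) * \prod_(i < n) Q (x (inord i)) (x (inord i.+1)).

Definition glauber_at (Q : Y -> Y -> R) (nu : Y -> R) (n : nat) (t : 'I_n.+1)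
    (x y : path_space n) : R :=
  (if t == ord0 then
     nu (y t) * Q (y t) (x (inord 1))
       / \sum_z nu z * Q z (x (inord 1))
   else if t == ord_max then
     Q (x (inord n.-1)) (y t)
   else
     Q (x (inord t.-1)) (y t) * Q (y t) (x (inord t.+1))
       / \sum_z Q (x (inord t.-1)) z * Q z (x (inord t.+1)))
  * \prod_(s | s != t) (x s == y s)%:R.

Definition glauber (Q : Y -> Y -> R) (nu : Y -> R) (n : nat)
    (x y : path_space n) : R :=
  n.+1%:R^-1 * \sum_(t < n.+1) glauber_at Q nu t x y.

End PathSpace.

Section Constants.
Variable R : realType.

Definition varkappa : R :=
  limn (fun m : nat => \sum_(1 <= k < m) 2 ^+ k * ln (1 / (1 - 4 ^- k)) : R).

Definition varphi (x : R) : R := Num.sqrt (1 + 1 / x ^+ 2) - 1 / x.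

Definition vartheta (x : R) : R :=
  if x == 0 then 0 else x * varphi x + ln (2 / x * varphi x).

End Constants.

(* Main.v *)
(* Let M be the moment generating function of f - E f and Phi the Lipschitz
   bound. By reversibility the Dirichlet form of e^(s f / 2) only sees the
   downward jumps of f, hence is at most (s^2/4) Phi^2 E[e^(s f)], and the
   Poincare inequality with constant L gives
     M(s) (1 - c^2 s^2) <= M(s/2)^2,  c = Phi / (2 sqrt L).
   Iterating s -> s/2 yields ln M(t) <= varkappa - ln (1 - c^2 t^2) for t c < 1,
   and the Chernoff bound is optimal at t c = varphi(a / c). *)
From mathcomp Require Import ring lra.
Require Import Defs.

Set Implicit Arguments.
Unset Strict Implicit.
Unset Printing Implicit Defensive.

Import Order.TTheory GRing.Theory Num.Theory.
Local Open Scope classical_set_scope.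
Local Open Scope ring_scope.

(** * Functional inequalities for a reversible finite chain *)

Section FiniteChain.
Variables (R : realType) (X : finType) (mu : X -> R) (P : X -> X -> R).
Implicit Types f g : X -> R.

Hypothesis mu_proba : is_proba mu.
Hypothesis P_ge0 : forall x y, 0 <= P x y.

Lemma expectation_le f g :
  (forall x, f x <= g x) -> expectation_on mu f <= expectation_on mu g.
Proof.
by move=> fg; apply: ler_sum => x _; apply: ler_wpM2l => //; exact: mu_proba.1.
Qed.

Lemma expectation_affine f (a b : R) :
  expectation_on mu (fun x => a * f x + b) = a * expectation_on mu f + b.
Proof.
rewrite /expectation_on mulr_sumr -[X in _ = _ + X]mul1r -mu_proba.2.
by rewrite mulr_suml -big_split; apply: eq_bigr => x _ /=; ring.
Qed.

Lemma expectationZ f (a : R) :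
  expectation_on mu (fun x => a * f x) = a * expectation_on mu f.
Proof. by rewrite /expectation_on mulr_sumr; apply: eq_bigr => x _; ring. Qed.

Lemma variance_sub g :
  variance_on mu g =
  expectation_on mu (fun x => g x ^+ 2) - expectation_on mu g ^+ 2.
Proof.
rewrite /variance_on; set m := expectation_on mu g.
transitivity (\sum_x (mu x * g x ^+ 2 + (- (2 * m) * (mu x * g x) + m ^+ 2 * mu x))).
  by apply: eq_bigr => x _; ring.
rewrite !big_split /= -!mulr_sumr mu_proba.2 -/(expectation_on mu g) -/m.
by rewrite /expectation_on; ring.
Qed.

Lemma variance_ge0 g : 0 <= variance_on mu g.
Proof.
by apply: sumr_ge0 => x _; rewrite mulr_ge0 ?sqr_ge0//; exact: mu_proba.1.
Qed.

Lemma varianceZ g (a : R) :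
  variance_on mu (fun x => a * g x) = a ^+ 2 * variance_on mu g.
Proof.
rewrite /variance_on expectationZ -[RHS]expectationZ.
by apply: eq_bigr => x _; ring.
Qed.

Lemma dirichlet_ge0 g : 0 <= dirichlet P mu g.
Proof.
apply: mulr_ge0; first by rewrite invr_ge0.
apply: sumr_ge0 => x _; apply: sumr_ge0 => y _.
by rewrite mulr_ge0 ?sqr_ge0// mulr_ge0//; exact: mu_proba.1.
Qed.

Lemma dirichletZ g (a : R) :
  dirichlet P mu (fun x => a * g x) = a ^+ 2 * dirichlet P mu g.
Proof.
rewrite /dirichlet mulrCA; congr (_ * _); rewrite mulr_sumr; apply: eq_bigr => x _.
by rewrite mulr_sumr; apply: eq_bigr => y _; ring.
Qed.

(** A function of nonzero variance, rescaled to variance 1, competes in the infimum defining the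
    gap, and both sides scale quadratically. *)
Lemma poincare g :
  spectral_gap mu P * variance_on mu g <= dirichlet P mu g.
Proof.
have [v0|vn0] := eqVneq (variance_on mu g) 0.
  by rewrite v0 mulr0 dirichlet_ge0.
have v_gt0 : 0 < variance_on mu g by rewrite lt0r vn0 variance_ge0.
set a := (Num.sqrt (variance_on mu g))^-1.
have a2 : a ^+ 2 = (variance_on mu g)^-1 by rewrite exprVn sqr_sqrtr// ltW.
rewrite -ler_pdivlMr// mulrC -a2 -dirichletZ.
apply: ge_inf.
  by exists 0 => _ [h _ <-]; exact: dirichlet_ge0.
by exists (fun x => a * g x) => //=; rewrite varianceZ a2 mulVf.
Qed.

Lemma lip_asym_sum f (Phi : R) x : lip_asym P f <= Phi ->
  \sum_y P x y * `|f x - f y| ^+ 2 * (0 < f x - f y)%R%:R <= Phi ^+ 2.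
Proof.
set S := \sum_y _ => lipP.
have S_ge0 : 0 <= S.
  by apply: sumr_ge0 => y _; rewrite mulr_ge0 ?ler0n// mulr_ge0 ?exprn_ge0.
have sP : Num.sqrt S <= Phi.
  exact: le_trans (le_bigmax _ (fun x : X => Num.sqrt
    (\sum_y P x y * `|f x - f y| ^+ 2 * (0 < f x - f y)%R%:R)) x) lipP.
rewrite -(sqr_sqrtr S_ge0) ler_sqr// ?nnegrE ?sqrtr_ge0//.
exact: le_trans (sqrtr_ge0 _) sP.
Qed.

(** Factoring out [expR (s / 2 * a)] leaves 1 - e^(-v) <= v with v = s (a - b) / 2 >= 0. Only the
    larger value enters the exponential on the right, so a jump is charged to its upper endpoint. *)
Lemma sqr_expRB_le (s a b : R) : 0 <= s -> b <= a ->
  (expR (s / 2 * a) - expR (s / 2 * b)) ^+ 2 <=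
  s ^+ 2 / 4 * (a - b) ^+ 2 * expR (s * a).
Proof.
move=> s0 ba.
have -> : s ^+ 2 / 4 * (a - b) ^+ 2 * expR (s * a)
        = (s / 2 * (a - b) * expR (s / 2 * a)) ^+ 2.
  rewrite [in RHS]exprMn -expRM_natl.
  have -> : 2%:R * (s / 2 * a) = s * a by field.
  by congr (_ * _); field.
have sab : 0 <= s / 2 * (a - b) by rewrite !mulr_ge0 ?subr_ge0.
have -> : expR (s / 2 * b) = expR (- (s / 2 * (a - b))) * expR (s / 2 * a).
  by rewrite -expRD; congr expR; ring.
rewrite ler_sqr ?nnegrE; last 2 first.
- by rewrite subr_ge0 ler_piMl ?expR_ge0// expR_le1 oppr_le0.
- by rewrite mulr_ge0 ?expR_ge0.
rewrite -{1}[expR (s / 2 * a)]mul1r -mulrBl ler_wpM2r ?expR_ge0//.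
by have := expR_ge1Dx (- (s / 2 * (a - b))); lra.
Qed.

Hypothesis P_rev : reversible_for mu P.

Lemma dirichlet_expR_le f (s Phi : R) : 0 <= s -> lip_asym P f <= Phi ->
  dirichlet P mu (fun x => expR (s / 2 * f x)) <=
  s ^+ 2 / 4 * Phi ^+ 2 * expectation_on mu (fun x => expR (s * f x)).
Proof.
move=> s0 lipP.
pose D x y := P x y * `|f x - f y| ^+ 2 * (0 < f x - f y)%R%:R.
pose S := \sum_x \sum_y mu x * expR (s * f x) * D x y.
have SE : S = \sum_x \sum_y mu y * expR (s * f y) * D y x.
  by rewrite /S exchange_big.
have D_ge0 x y : 0 <= D x y by rewrite mulr_ge0 ?ler0n// mulr_ge0 ?exprn_ge0.
(* Each copy of [S] pays for one direction: at most one of the two indicators is nonzero for a pair,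
   and reversibility matches the weights of an upward jump and its reverse. *)
have step : \sum_x \sum_y (expR (s / 2 * f x) - expR (s / 2 * f y)) ^+ 2
              * (mu x * P x y) <= s ^+ 2 / 4 * (S + S).
  rewrite {2}SE -big_split mulr_sumr; apply: ler_sum => x _ /=.
  rewrite -big_split mulr_sumr; apply: ler_sum => y _ /=.
  have mP : 0 <= mu x * P x y by rewrite mulr_ge0//; exact: mu_proba.1.
  rewrite /D !real_normK ?num_real// !subr_gt0.
  have [fxy|fxy|fxy] := ltgtP (f x) (f y).
  - rewrite !mulr0 add0r mulr1.
    have -> : s ^+ 2 / 4 * (mu y * expR (s * f y) * (P y x * (f y - f x) ^+ 2))
      = s ^+ 2 / 4 * (f y - f x) ^+ 2 * expR (s * f y) * (mu y * P y x) by ring.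
    rewrite (P_rev y x) ler_wpM2r// -sqrrN opprB.
    by apply: sqr_expRB_le => //; exact: ltW.
  - rewrite !mulr0 addr0 mulr1.
    have -> : s ^+ 2 / 4 * (mu x * expR (s * f x) * (P x y * (f x - f y) ^+ 2))
      = s ^+ 2 / 4 * (f x - f y) ^+ 2 * expR (s * f x) * (mu x * P x y) by ring.
    rewrite ler_wpM2r//.
    by apply: sqr_expRB_le => //; exact: ltW.
  - by rewrite fxy !subrr expr0n /= mul0r !(mulr0, mul0r) addr0 mulr0.
have S_le : S <= Phi ^+ 2 * expectation_on mu (fun x => expR (s * f x)).
  rewrite /expectation_on mulr_sumr; apply: ler_sum => x _.
  rewrite -mulr_sumr mulrC ler_wpM2r ?mulr_ge0 ?expR_ge0//; first exact: mu_proba.1.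
  exact: lip_asym_sum.
have s2 : 0 <= s ^+ 2 / 4 by rewrite mulr_ge0 ?sqr_ge0.
have := ler_wpM2l s2 S_le; rewrite /dirichlet; lra.
Qed.

Definition mgf f (s : R) : R := expectation_on mu (fun x => expR (s * f x)).

Lemma mgf_gt0 f s : 0 < mgf f s.
Proof.
have mu_ge0 := mu_proba.1.
have h x : 0 <= mu x * expR (s * f x) by rewrite mulr_ge0 ?expR_ge0.
rewrite lt0r sumr_ge0 ?andbT//; apply/eqP => /psumr_eq0P m0.
have : \sum_x mu x = 0.
  apply: big1 => x _; have /eqP := m0 (fun x _ => h x) x isT.
  by rewrite mulf_eq0 expR_eq0 orbF => /eqP.
by rewrite mu_proba.2; apply/eqP; rewrite oner_eq0.
Qed.

(** This is the Poincare inequality for e^(s f / 2), whose second moment is [mgf f s] and whose mean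
    is [mgf f (s / 2)]. *)
Lemma mgf_half f (L s Phi : R) : 0 < L -> L <= spectral_gap mu P -> 0 <= s ->
  lip_asym P f <= Phi ->
  mgf f s * (1 - (s * (Phi / (2 * Num.sqrt L))) ^+ 2) <= mgf f (s / 2) ^+ 2.
Proof.
move=> L0 Lgap s0 lipP.
have := dirichlet_expR_le s0 lipP; set g := fun x => expR _ => Dg.
have := le_trans (poincare g) Dg.
have := ler_wpM2r (variance_ge0 g) Lgap => /le_trans /[apply].
rewrite variance_sub.
have -> : expectation_on mu (fun x => g x ^+ 2) = mgf f s.
  apply: eq_bigr => x _; rewrite /g -expRM_natl.
  by congr (_ * expR _); field.
rewrite -[expectation_on mu g]/(mgf f (s / 2)) -/(mgf f s) => h.
have -> : (s * (Phi / (2 * Num.sqrt L))) ^+ 2 = s ^+ 2 / 4 * Phi ^+ 2 / L.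
  rewrite !exprMn exprVn exprMn sqr_sqrtr ?ltW//.
  by field; rewrite gt_eqF.
rewrite -(ler_pM2l L0).
have -> : L * (mgf f s * (1 - s ^+ 2 / 4 * Phi ^+ 2 / L)) =
          L * mgf f s - s ^+ 2 / 4 * Phi ^+ 2 * mgf f s.
  by field; rewrite gt_eqF.
by rewrite lerBlDr -lerBlDl -mulrBr.
Qed.

End FiniteChain.

(** * The series [varkappa], the halving iteration and the optimal parameter [varphi] *)

Section Constants.
Variable R : realType.
Implicit Types (x u : R) (k m : nat).

Lemma ln_inv1B_ge0 x : 0 <= x < 1 -> 0 <= ln (1 / (1 - x)).
Proof.
by move=> /andP[x0 x1]; rewrite div1r ln_ge0// invf_ge1 ?lerBlDl ?lerDr// subr_gt0.
Qed.

Lemma ln_inv1B_le x y : 0 <= x <= y -> y < 1 ->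
  ln (1 / (1 - x)) <= ln (1 / (1 - y)).
Proof.
move=> /andP[x0 xy] y1; rewrite !div1r ler_ln ?posrE ?invr_gt0 ?subr_gt0//.
  by rewrite lef_pV2 ?posrE ?subr_gt0 ?lerB//; exact: le_lt_trans y1.
exact: le_lt_trans y1.
Qed.

Lemma invr4X_bounds k : (0 < k)%N -> 0 <= (4 ^- k : R) <= 1 / 4.
Proof.
move=> k0; rewrite invr_ge0 exprn_ge0// div1r lef_pV2 ?posrE ?exprn_gt0//=.
by rewrite -{1}[4]expr1 ler_weXn2l// ler1n.
Qed.

Lemma varkappa_term_ge0 k : (0 < k)%N ->
  0 <= 2 ^+ k * ln (1 / (1 - 4 ^- k)) :> R.
Proof.
move=> /invr4X_bounds /andP[q0 q1]; rewrite mulr_ge0 ?exprn_ge0//.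
by apply: ln_inv1B_ge0; rewrite q0 /=; lra.
Qed.

(** A geometric majorant: ln (1 / (1 - q)) <= q / (1 - q) <= 2 q for q = 4^-k <= 1/4, and 2^k 4^-k =
    2^-k. *)
Lemma varkappa_term_le k : (0 < k)%N ->
  2 ^+ k * ln (1 / (1 - 4 ^- k)) <= 2 * 2 ^- k :> R.
Proof.
move=> /invr4X_bounds; set q : R := 4 ^- k => /andP[q0 q1].
have q1' : 0 < 1 - q by lra.
have lnq : ln (1 / (1 - q)) <= 2 * q.
  have -> : 1 / (1 - q) = 1 + q / (1 - q) by field; rewrite gt_eqF.
  have q2 : q / (1 - q) <= 2 * q by rewrite ler_pdivrMr//; nra.
  have q3 : 0 <= q / (1 - q) by rewrite divr_ge0// ltW.
  by apply: le_trans (le_ln1Dx _) q2; lra.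
apply: le_trans (ler_wpM2l _ lnq) _; first by rewrite exprn_ge0.
have -> : q = 2 ^- k * 2 ^- k by rewrite /q -invfM -exprMn -natrM.
by rewrite mulrCA mulrA -(mulrA 2) mulVKf// mulrC lexx.
Qed.

(** The partial sums increase and stay below 2, so [limn] is a genuine limit and dominates each of
    them. *)
Lemma varkappa_sum_le m :
  \sum_(1 <= k < m) 2 ^+ k * ln (1 / (1 - 4 ^- k)) <= varkappa R.
Proof.
pose u i : R := \sum_(1 <= k < i) 2 ^+ k * ln (1 / (1 - 4 ^- k)).
rewrite -[leLHS]/(u m).
have u_nd : nondecreasing_seq u.
  apply/nondecreasing_seqP => -[|i]; first by rewrite /u !big_geq.
  by rewrite /u [leRHS]big_nat_recr//= lerDl varkappa_term_ge0.
apply: (nondecreasing_cvgn_le u_nd); apply: nondecreasing_is_cvgn => //.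
exists 2 => _ [i _ <-].
case: i => [|i]; first by rewrite /u big_geq.
(* The exact partial sum of the geometric majorant is carried along, since the bare bound 2 is not
   inductive. *)
suff: u i.+1 <= 2 * (1 - 2 ^- i).
  have : 0 <= 2 ^- i :> R by rewrite invr_ge0 exprn_ge0.
  by lra.
elim: i => [|i IH]; first by rewrite /u big_geq// expr0 invr1 subrr mulr0.
rewrite /u big_nat_recr//= -/(u i.+1).
have -> : 2 * (1 - 2 ^- i.+1) = 2 * (1 - 2 ^- i) + 2 * 2 ^- i.+1 :> R.
  by rewrite exprS; field; rewrite expf_neq0.
by rewrite lerD// varkappa_term_le.
Qed.

Lemma varkappa_ge0 : 0 <= varkappa R.
Proof. by have := varkappa_sum_le 1; rewrite big_geq. Qed.

(** In logarithms one halving reads ln M(s) <= 2 ln M(s/2) + ln (1 / (1 - (s c)^2)); at s = t / 2^k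
    it carries the weight 2^k. *)
Lemma ln_iterate (M : R -> R) (c t : R) m :
  (forall s, 0 < M s) ->
  (forall s, 0 <= s -> M s * (1 - (s * c) ^+ 2) <= M (s / 2) ^+ 2) ->
  0 <= t -> 0 <= c -> t * c < 1 ->
  ln (M t) <= 2 ^+ m * ln (M (t / 2 ^+ m))
              + \sum_(0 <= k < m) 2 ^+ k * ln (1 / (1 - (t * c) ^+ 2 * 4 ^- k)).
Proof.
move=> M_gt0 M_half t0 c0 tc1.
elim: m => [|m IH]; first by rewrite big_geq// expr0 divr1 mul1r addr0.
apply: le_trans IH _; rewrite big_nat_recr//= [X in _ <= _ + X]addrC addrA.
rewrite lerD2r exprS -mulrA [X in _ <= X + _]mulrCA -mulrDr ler_wpM2l ?exprn_ge0//.
set s := t / 2 ^+ m.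
have -> : t / (2 * 2 ^+ m) = s / 2 by rewrite /s invfM; ring.
have -> : (t * c) ^+ 2 * 4 ^- m = (s * c) ^+ 2.
  have -> : 4 ^+ m = 2 ^+ m * 2 ^+ m :> R by rewrite -exprMn -natrM.
  by rewrite /s exprMn; field; rewrite expf_neq0.
have s0 : 0 <= s by rewrite divr_ge0// exprn_ge0.
have sc1 : s * c < 1.
  apply: le_lt_trans tc1; rewrite ler_wpM2r// ler_pdivrMr ?exprn_gt0//.
  by rewrite ler_peMr// exprn_ege1// ler1n.
have q_gt0 : 0 < 1 - (s * c) ^+ 2.
  by rewrite subr_gt0 expr_lt1// mulr_ge0.
have := M_half s s0; rewrite -ler_pdivlMr// => h.
have := h; rewrite -ler_ln ?posrE ?divr_gt0 ?exprn_gt0// => /le_trans; apply.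
by rewrite lnM ?posrE ?invr_gt0 ?exprn_gt0// lnXn// div1r mulr_natl.
Qed.

(* The k = 0 term is kept exact; the others are estimated at t c = 1, which
   produces varkappa. The quadratic bound near 0 makes the remainder
   2^m ln (M (t / 2^m)) vanish. *)
Lemma ln_le_varkappa (M : R -> R) (c t K s0 : R) :
  (forall s, 0 < M s) ->
  (forall s, 0 <= s -> M s * (1 - (s * c) ^+ 2) <= M (s / 2) ^+ 2) ->
  0 <= K -> 0 < s0 -> (forall s, 0 <= s <= s0 -> M s <= 1 + K * s ^+ 2) ->
  0 <= t -> 0 <= c -> t * c < 1 ->
  ln (M t) <= varkappa R - ln (1 - (t * c) ^+ 2).
Proof.
move=> M_gt0 M_half K0 s0_gt0 M_quad t0 c0 tc1.
apply/ler_addgt0Pl => e e0.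
(* [W] = 2^(N+1) must exceed t / s0, to bring t / W into the quadratic range, and K t^2 / e, to make
   the remainder K t^2 / W at most e. *)
pose N := Num.bound (t / s0 + K * t ^+ 2 / e).
have a0 : 0 <= t / s0 by rewrite divr_ge0// ltW.
have b0 : 0 <= K * t ^+ 2 / e by rewrite divr_ge0 ?mulr_ge0 ?sqr_ge0// ltW.
have : t / s0 + K * t ^+ 2 / e < 2 ^+ N.+1.
  apply: lt_trans (archi_boundP (addr_ge0 a0 b0)) _.
  by rewrite -natrX ltr_nat -/N (ltn_trans (ltnSn _))// ltn_expl.
set W : R := 2 ^+ N.+1 => W_big.
have W0 : 0 < W by rewrite exprn_gt0.
have tW : t / W <= s0.
  by rewrite ler_pdivrMr// [leRHS]mulrC -ler_pdivrMr//; lra.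
have KW : K * t ^+ 2 / W <= e.
  by rewrite ler_pdivrMr// [leRHS]mulrC -ler_pdivrMr//; lra.
apply: le_trans (ln_iterate N.+1 M_gt0 M_half t0 c0 tc1) _; rewrite -/W.
apply: lerD.
  apply: le_trans KW.
  have tW0 : 0 <= t / W by rewrite divr_ge0// ltW.
  have x0 : 0 <= K * (t / W) ^+ 2 by rewrite mulr_ge0// sqr_ge0.
  have h : ln (M (t / W)) <= K * (t / W) ^+ 2.
    have x1 : 0 < 1 + K * (t / W) ^+ 2 by lra.
    have x2 : -1 < K * (t / W) ^+ 2 by lra.
    apply: le_trans (le_ln1Dx x2).
    by rewrite ler_ln ?posrE// M_quad// tW0 tW.
  apply: le_trans (ler_wpM2l (ltW W0) h) _.
  by rewrite le_eqVlt; apply/orP; left; apply/eqP; field; rewrite gt_eqF.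
have u0 : 0 <= t * c by rewrite mulr_ge0.
have u2 : (t * c) ^+ 2 < 1 by rewrite expr_lt1.
rewrite big_nat_recl//= expr0 invr1 mul1r mulr1 div1r lnV ?posrE ?subr_gt0//.
rewrite addrC lerD2r; apply: le_trans (varkappa_sum_le N.+1).
rewrite big_add1 /=; apply: ler_sum => k _.
have /andP[q0 q1] := @invr4X_bounds k.+1 isT.
rewrite ler_wpM2l ?exprn_ge0// ln_inv1B_le//; last by lra.
by rewrite mulr_ge0 ?sqr_ge0//= ler_piMl// ltW.
Qed.

(* varphi b is the root in ]0, 1[ of b u^2 + 2 u - b, the critical point of
   u b + ln (1 - u^2). *)
Lemma varphi_root (b : R) : 0 < b ->
  0 < varphi b < 1 /\ 1 - varphi b ^+ 2 = 2 / b * varphi b.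
Proof.
move=> b0; rewrite /varphi; set s := Num.sqrt _; set d := 1 / b.
have d0 : 0 < d by rewrite divr_gt0.
have s2 : s ^+ 2 = 1 + d ^+ 2.
  by rewrite /s sqr_sqrtr ?expr_div_n ?expr1n// addr_ge0// divr_ge0// sqr_ge0.
have s0 : 0 <= s by exact: sqrtr_ge0.
have -> : 2 / b = 2 * d by rewrite /d div1r.
(* Here [varphi b] is s - d with s^2 = 1 + d^2: the identity is 1 - (s - d)^2 = 2 d (s - d), and the
   bounds say d < s < 1 + d. *)
split; last by nra.
by apply/andP; split; nra.
Qed.

End Constants.

(** * From exponential moments to the tail bound *)

Section Concentration.
Variables (R : realType) (X : finType) (mu : X -> R) (P : X -> X -> R).

(** Inverting 1 - x <= e^(-x) gives e^x <= 1 / (1 - x), which the quadratic dominates up to x =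
    1/2. *)
Lemma expR_le_quadratic (x : R) : x <= 1 / 2 -> expR x <= 1 + x + 2 * x ^+ 2.
Proof.
move=> x12; have x1 : 0 < 1 - x by lra.
apply: (@le_trans _ _ (1 - x)^-1).
  rewrite -[expR x]invrK -expRN lef_pV2 ?posrE ?expR_gt0//.
  exact: expR_ge1Dx.
rewrite -[leLHS]mul1r ler_pdivrMr//.
have -> : (1 + x + 2 * x ^+ 2) * (1 - x) = 1 + x ^+ 2 * (1 - 2 * x) by ring.
by rewrite lerDl mulr_ge0 ?sqr_ge0//; lra.
Qed.

Hypothesis mu_proba : is_proba mu.

(** Centering removes the linear term of the expansion at 0; this supplies the quadratic hypothesis
    of [ln_le_varkappa]. *)
Lemma mgf_quadratic (f : X -> R) : expectation_on mu f = 0 ->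
  exists K s0 : R, [/\ 0 <= K, 0 < s0 &
    forall s, 0 <= s <= s0 -> mgf mu f s <= 1 + K * s ^+ 2].
Proof.
(* The added 1 keeps [B] positive; s <= 1 / (2 B) then forces s f(x) <= 1/2. *)
move=> f0; pose B := 1 + \sum_x `|f x|.
have fB x : f x < B.
  rewrite /B (bigD1 x)//=; have := ler_norm (f x).
  have : 0 <= \sum_(i | i != x) `|f i| by apply: sumr_ge0.
  by lra.
have B0 : 0 < B by rewrite ltr_pwDl// sumr_ge0.
exists (2 * expectation_on mu (fun x => f x ^+ 2)), (1 / (2 * B)); split.
- rewrite mulr_ge0// sumr_ge0// => x _; rewrite mulr_ge0 ?sqr_ge0//.
  exact: mu_proba.1.
- by rewrite divr_gt0// mulr_gt0.
move=> s /andP[s_ge0 sB].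
(* The shape 1 * _ + 1 fits [expectation_affine]. *)
have h x : expR (s * f x) <= 1 * (s * f x + 2 * s ^+ 2 * f x ^+ 2) + 1.
  apply: le_trans (expR_le_quadratic _) _; last by rewrite exprMn; lra.
  apply: (@le_trans _ _ (s * B)); first by rewrite ler_wpM2l// ltW.
  by move: sB; rewrite ler_pdivlMr ?mulr_gt0//; lra.
apply: le_trans (expectation_le mu_proba h) _.
rewrite (expectation_affine mu_proba) mul1r addrC lerD2l.
have -> : expectation_on mu (fun x => s * f x + 2 * s ^+ 2 * f x ^+ 2)
  = s * expectation_on mu f + 2 * s ^+ 2 * expectation_on mu (fun x => f x ^+ 2).
  rewrite /expectation_on !mulr_sumr -big_split.
  by apply: eq_bigr => x _ /=; ring.
by rewrite f0 mulr0 add0r mulrAC.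
Qed.

Lemma upper_tail_chernoff (f : X -> R) (a t : R) : 0 <= t ->
  upper_tail mu f a <=
  expR (- (t * a)) * mgf mu (fun x => f x - expectation_on mu f) t.
Proof.
move=> t0; rewrite /upper_tail /mgf /expectation_on mulr_sumr.
rewrite -/(expectation_on mu f) big_mkcond; apply: ler_sum => x _.
have mu0 := mu_proba.1 x; rewrite mulrCA -expRD; case: ifPn => h.
  rewrite ler_peMr// -expR0 ler_expR addrC -mulrBr mulr_ge0// subr_ge0//.
by rewrite mulr_ge0 ?expR_ge0.
Qed.

Lemma upper_tail_le1 (f : X -> R) (a : R) : upper_tail mu f a <= 1.
Proof.
rewrite -mu_proba.2 /upper_tail big_mkcond; apply: ler_sum => x _.
by case: ifP => // _; exact: mu_proba.1.
Qed.

Lemma lip_asymB (f : X -> R) (m : R) :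
  lip_asym P (fun x => f x - m) = lip_asym P f.
Proof.
apply: eq_bigr => x _; congr Num.sqrt; apply: eq_bigr => y _.
by have -> : f x - m - (f y - m) = f x - f y by ring.
Qed.

Hypothesis P_ge0 : forall x y, 0 <= P x y.
Hypothesis P_rev : reversible_for mu P.

Lemma spectral_gap_upper_tail (f : X -> R) (L Phi a : R) :
  0 < L -> L <= spectral_gap mu P -> 0 < Phi -> lip_asym P f <= Phi -> 0 <= a ->
  (lne (upper_tail mu f a)%:E
     <= (varkappa R - vartheta (a * (2 * Num.sqrt L / Phi)))%:E)%E.
Proof.
move=> L0 Lgap Phi0 lipP a0.
pose c := Phi / (2 * Num.sqrt L).
have sL : 0 < Num.sqrt L by rewrite sqrtr_gt0.
have c0 : 0 < c by rewrite divr_gt0// mulr_gt0.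
have -> : a * (2 * Num.sqrt L / Phi) = a / c by rewrite /c invf_div.
(* At a / c = 0 the bound is [varkappa], which is nonnegative, while the logarithm of a probability
   is at most 0. *)
rewrite /vartheta; case: eqP => [ac|/eqP acn0].
  rewrite subr0; apply: (@le_trans _ _ 0%E).
    by rewrite lne_le0 lee_fin upper_tail_le1.
  by rewrite lee_fin varkappa_ge0.
have b0 : 0 < a / c by rewrite lt0r acn0 divr_ge0// ltW.
set b := a / c in b0 *.
have [/andP[u0 u1] uE] := varphi_root b0; set u := varphi b in u0 u1 uE *.
have [T0|T0] := leP (upper_tail mu f a) 0.
  by rewrite le0_lneNy ?leNye// lee_fin.
rewrite lne_EFin// lee_fin.
pose g x := f x - expectation_on mu f.
have g0 : expectation_on mu g = 0.
  have := expectation_affine mu_proba f 1 (- expectation_on mu f).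
  rewrite mul1r subrr => <-; apply: eq_bigr => x _.
  by rewrite /g mul1r.
have [K [s0 [K0 s0_gt0 M_quad]]] := mgf_quadratic g0.
have M_gt0 := mgf_gt0 mu_proba g.
have lipg : lip_asym P g <= Phi by rewrite lip_asymB.
have M_half s : 0 <= s -> mgf mu g s * (1 - (s * c) ^+ 2) <= mgf mu g (s / 2) ^+ 2.
  by move=> ?; exact: mgf_half.
(* With this t the Chernoff exponent is varkappa - b u - ln (1 - u^2), and 1 - u^2 = (2 / b) u turns
   it into varkappa - vartheta(b). *)
pose t := u / c.
have t0 : 0 <= t by rewrite divr_ge0// ltW.
have tc : t * c = u by rewrite divfK// gt_eqF.
have ta : t * a = b * u by rewrite /t /b; ring.
have := ln_le_varkappa M_gt0 M_half K0 s0_gt0 M_quad t0 (ltW c0).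
rewrite tc uE => /(_ u1) ln_mgf.
have := upper_tail_chernoff f a t0; rewrite -/g.
rewrite -ler_ln ?posrE ?mulr_gt0 ?expR_gt0// lnM ?posrE ?expR_gt0// expRK ta.
lra.
Qed.

End Concentration.

(** * The path measure and the reversibility of Glauber dynamics *)

Section PathSpace.
Variables (R : realType) (Y : finType) (Q : Y -> Y -> R) (nu : Y -> R).
Hypothesis Q_trans : is_transition Q.
Hypothesis nu_proba : is_proba nu.

Lemma path_measure_ge0 n (x : path_space Y n) : 0 <= path_measure Q nu x.
Proof.
apply: mulr_ge0; first exact: nu_proba.1.
by apply: prodr_ge0 => i _; exact: Q_trans.1.
Qed.

Lemma glauber_ge0 n (x y : path_space Y n) : 0 <= glauber Q nu x y.
Proof.
have [Q0 _] := Q_trans; have [nu0 _] := nu_proba.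
apply: mulr_ge0; first by rewrite invr_ge0.
apply: sumr_ge0 => t _; apply: mulr_ge0; last by apply: prodr_ge0.
case: ifP => _; [|case: ifP => // _];
  by apply: divr_ge0; [exact: mulr_ge0|apply: sumr_ge0 => z _; exact: mulr_ge0].
Qed.

(** Being a bijection, it allows sums over paths to be computed by induction on n, the last state
    being summed out first. *)
Definition path_rcons n (xz : path_space Y n * Y) : path_space Y n.+1 :=
  [ffun i => if unlift ord_max i is Some j then xz.1 j else xz.2].

Lemma path_rcons_inord n (xz : path_space Y n * Y) k : (k <= n)%N ->
  path_rcons xz (inord k) = xz.1 (inord k).
Proof.
move=> kn; have -> : inord k = lift ord_max (inord k : 'I_n.+1) :> 'I_n.+2.
  apply: val_inj; rewrite /= inordK ?ltnS ?(leq_trans kn)// inordK ?ltnS//.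
  by rewrite /bump leqNgt ltnS kn.
by rewrite ffunE liftK.
Qed.

Lemma path_rcons_max n (xz : path_space Y n * Y) :
  path_rcons xz (inord n.+1) = xz.2.
Proof.
have -> : inord n.+1 = ord_max :> 'I_n.+2 by apply: val_inj; rewrite /= inordK.
by rewrite ffunE unlift_none.
Qed.

Lemma ord0_inord n : ord0 = inord 0 :> 'I_n.+1.
Proof. by apply: val_inj; rewrite /= inordK. Qed.

Lemma path_measure_rcons n (xz : path_space Y n * Y) :
  path_measure Q nu (path_rcons xz) =
  path_measure Q nu xz.1 * Q (xz.1 (inord n)) xz.2.
Proof.
rewrite /path_measure big_ord_recr /= path_rcons_max path_rcons_inord// mulrA.
congr (_ * _ * _); first by rewrite !ord0_inord path_rcons_inord.
by apply: eq_bigr => i _; rewrite !path_rcons_inord// ltnW.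
Qed.

Lemma path_rcons_bij n : bijective (@path_rcons n).
Proof.
exists (fun w : path_space Y n.+1 =>
  ([ffun j => w (lift ord_max j)] : path_space Y n, w ord_max)).
- move=> [x z]; congr pair; last by rewrite ffunE unlift_none.
  by apply/ffunP => j; rewrite !ffunE liftK.
- move=> w; apply/ffunP => i; rewrite ffunE.
  by case: unliftP => [j|] ->; rewrite ?ffunE.
Qed.

(** Summing out the last state costs a factor 1 because the rows of [Q] sum to 1; for n = 0 the
    measure is [nu] itself. *)
Lemma path_measure_proba n : is_proba (@path_measure R Y Q nu n).
Proof.
split; first exact: path_measure_ge0.
elim: n => [|n IH].
  rewrite (reindex (fun z : Y => [ffun _ => z] : path_space Y 0)) /=.
    rewrite -[RHS]nu_proba.2; apply: eq_bigr => z _.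
    by rewrite /path_measure big_ord0 mulr1 ffunE.
  exists (fun x : path_space Y 0 => x ord0) => x _; first by rewrite ffunE.
  by apply/ffunP => i; rewrite ffunE (ord1 i).
rewrite (reindex (@path_rcons n)); last exact/onW_bij/path_rcons_bij.
rewrite -[RHS]IH; under eq_bigr do rewrite path_measure_rcons.
rewrite -(pair_bigA _ (fun x z => path_measure Q nu x * Q (x (inord n)) z)) /=.
by apply: eq_bigr => x _; rewrite -mulr_sumr Q_trans.2 mulr1.
Qed.

(** With a single indicator, reversibility need only be checked for paths agreeing off t. *)
Lemma prod_eq_offE n (t : 'I_n.+1) (x y : path_space Y n) :
  \prod_(s | s != t) (x s == y s)%:R = [forall (s | s != t), x s == y s]%:R :> R.
Proof.
case: (boolP [forall (s | s != t), x s == y s]) => [/forallP xy|].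
  by apply: big1 => s st; have := xy s; rewrite st /= => ->.
rewrite negb_forall => /existsP[s]; rewrite negb_imply => /andP[st xys].
by apply/eqP; rewrite prodf_seq_eq0; apply/hasP; exists s;
  rewrite ?mem_index_enum// st (negbTE xys) eqxx.
Qed.

(* The factors of the path measure which involve the site t are exactly the
   numerator of the resampling kernel at t. *)
Lemma glauber_at_reversible n (t : 'I_n.+1) : (0 < n)%N ->
  reversible_for (@path_measure R Y Q nu n) (@glauber_at R Y Q nu n t).
Proof.
move=> n0 x y; rewrite /glauber_at !prod_eq_offE.
have -> : [forall (s | s != t), y s == x s] = [forall (s | s != t), x s == y s].
  by apply: eq_forallb => s; rewrite [y s == _]eq_sym.
case: (boolP [forall (s | s != t), x s == y s]) => [/forallP xy|_]; last by rewrite !mulr0.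
rewrite !mulr1.
have off k : (k <= n)%N -> k != t :> nat -> x (inord k) = y (inord k).
  move=> kn kt; have := xy (inord k).
  have -> /= : inord k != t by rewrite -val_eqE /= inordK.
  by move=> /eqP.
have siteE (z : path_space Y n) : z t = z (inord t) by rewrite inord_val.
rewrite !siteE /path_measure ord0_inord.
have tn : (t <= n)%N by rewrite -ltnS.
case: ifPn => [/eqP tE|t0].
  have {tE}tE : t = 0%N :> nat by rewrite tE /= inordK.
  (* Factor i of the product joins sites i and i + 1, so site 0 meets only factor 0. *)
  rewrite (bigD1 (Ordinal n0))//= [in RHS](bigD1 (Ordinal n0))//= tE.
  rewrite (off 1%N) ?tE//.
  rewrite (eq_bigr (fun i : 'I_n => Q (y (inord i)) (y (inord i.+1)))); last first.
    by move=> i; rewrite -val_eqE /= => i0; rewrite !off ?tE// ltnW.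
  by ring.
have {}t0 : (0 < t)%N by rewrite lt0n; apply: contra t0 => /eqP t0;
  rewrite -val_eqE /= t0 inordK.
have t1n : (t.-1 < n)%N by rewrite prednK.
have t1t : t.-1 != t :> nat by rewrite neq_ltn prednK// leqnn.
rewrite (off 0%N) -?lt0n// ?(eq_sym 0%N) ?lt0n//; last by rewrite neq_ltn t0.
case: ifPn => [/eqP tE|tmax].
  have {tE}tE : t = n :> nat by rewrite tE.
  (* The last site meets only factor n - 1. *)
  rewrite (bigD1 (Ordinal t1n))//= [in RHS](bigD1 (Ordinal t1n))//= prednK//.
  have -> : n.-1 = t.-1 by rewrite tE.
  rewrite (off t.-1) ?(ltnW t1n)//.
  rewrite (eq_bigr (fun i : 'I_n => Q (y (inord i)) (y (inord i.+1)))); last first.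
    move=> i; rewrite -val_eqE /= => i0; rewrite !off// ?(ltnW (ltn_ord i))//.
    - by apply: contra i0 => /eqP <-.
    - by rewrite tE neq_ltn ltn_ord.
  by ring.
have {}tn : (t < n)%N by rewrite ltn_neqAle tn andbT.
(* An interior site meets the two factors t - 1 and t. *)
rewrite (bigD1 (Ordinal t1n))//= [in RHS](bigD1 (Ordinal t1n))//= prednK//.
have ti : Ordinal tn != Ordinal t1n by rewrite -val_eqE /= eq_sym.
rewrite (bigD1 (Ordinal tn))//= [in RHS](bigD1 (Ordinal tn))//=.
rewrite (off t.-1) ?(ltnW t1n)// (off t.+1)//; last by rewrite neq_ltn leqnn orbT.
rewrite (eq_bigr (fun i : 'I_n => Q (y (inord i)) (y (inord i.+1)))); last first.
  move=> i; rewrite -!val_eqE /= => /andP[i0 i1].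
  rewrite !off// ?(ltnW (ltn_ord i))//.
  by apply: contra i0 => /eqP <-.
by ring.
Qed.

Lemma glauber_reversible n : (0 < n)%N ->
  reversible_for (@path_measure R Y Q nu n) (@glauber R Y Q nu n).
Proof.
move=> n0 x y; rewrite /glauber [LHS]mulrCA [RHS]mulrCA; congr (_ * _).
by rewrite !mulr_sumr; apply: eq_bigr => t _; exact: glauber_at_reversible.
Qed.

End PathSpace.

(** * Specialization to the path space *)

Theorem corollary3p2 (R : realType) (Y : finType)
    (Q : Y -> Y -> R) (nu : Y -> R) (n : nat)
    (lambda1 p C : R) (f : path_space Y n -> R)
    (hY : (2 <= #|Y|)%N)
    (hQ : is_transition Q)
    (hQirr : irreducible_kernel Q)
    (hQaper : aperiodic Q)
    (hnu : is_proba nu)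
    (hrev : reversible_for nu Q)
    (hn : (0 < n)%N)
    (hmu : forall x : path_space Y n, 0 < path_measure Q nu x)
    (hlambda1 : 0 < lambda1)
    (hgap : lambda1 / n.+1%:R
              <= spectral_gap (@path_measure R Y Q nu n) (@glauber R Y Q nu n))
    (hC : 0 < C)
    (hLip : lip_asym (@glauber R Y Q nu n) f <= C / (n.+1%:R `^ p)) :
  forall a : R, 0 <= a ->
    (lne (upper_tail (@path_measure R Y Q nu n) f
            (a * (n.+1%:R `^ (- p + 1 / 2))))%:E
     <= (varkappa R - vartheta (a * (2 * Num.sqrt lambda1 / C)))%:E)%E.
Proof.
move=> a a0; have n0 : 0 < n.+1%:R :> R by [].
(* The powers of n + 1 cancel: (n+1)^(-p+1/2) from the level, (n+1)^(-1/2) from the root of the gap,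
   (n+1)^p from the Lipschitz bound. *)
have -> : a * (2 * Num.sqrt lambda1 / C) = a * (n.+1%:R `^ (- p + 1 / 2))
    * (2 * Num.sqrt (lambda1 / n.+1%:R) / (C / n.+1%:R `^ p)).
  rewrite powRD; last by rewrite (gt_eqF n0) implybT.
  rewrite powRN div1r powR12_sqrt ?ltW// sqrtrM ?ltW// sqrtrV ?ltW//.
  have p0 := powR_gt0 p n0; have s0 : 0 < Num.sqrt n.+1%:R :> R by rewrite sqrtr_gt0.
  by field; rewrite !gt_eqF.
apply: (spectral_gap_upper_tail (P := @glauber R Y Q nu n)) => //.
- exact: path_measure_proba.
- by move=> x y; exact: glauber_ge0.
- exact: glauber_reversible.
- by rewrite divr_gt0.
- by rewrite divr_gt0// powR_gt0.
- by rewrite mulr_ge0// powR_ge0.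
Qed.
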